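(* For a compact Hausdorff flow $(X,T)$, every point of $X$ is almost automorphic if and only if the enveloping semigroup $\mathcal E(X,T)$ is a compact Hausdorff topological group in the topology of pointwise convergence in $X^X$.
   Context: $X$ compact Hausdorff, $T$ a topological group acting continuously on $X$. A point $x$ is almost automorphic if for every net $\{t_i\}\subset T$ with $t_ix\to y$ it holds that $t_i^{-1}y\to x$. The enveloping semigroup $\mathcal E(X,T)$ is the closure of $T$ in $X^X$ with the product topology, with composition as operation. *)

(* Defs.v *)
From Stdlib Require Import List.

Definition is_topology {X : Type} (op : (X -> Prop) -> Prop) : Prop :=
  op (fun _ => True) /\
  (forall U V, op U -> op V -> op (fun x => U x /\ V x)) /\
  (forall F : (X -> Prop) -> Prop, (forall U, F U -> op U) ->
      op (fun x => exists U, F U /\ U x)).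

Definition continuous {A B : Type} (oA : (A -> Prop) -> Prop)
  (oB : (B -> Prop) -> Prop) (f : A -> B) : Prop :=
  forall V, oB V -> oA (fun a => V (f a)).

Definition product_open {A B : Type} (oA : (A -> Prop) -> Prop)
  (oB : (B -> Prop) -> Prop) (W : A * B -> Prop) : Prop :=
  forall p, W p -> exists U V, oA U /\ oB V /\ U (fst p) /\ V (snd p) /\
    forall q, U (fst q) -> V (snd q) -> W q.

Definition sub_open {X : Type} {P : X -> Prop} (o : (X -> Prop) -> Prop)
  (W : sig P -> Prop) : Prop :=
  exists U, o U /\ forall s, W s <-> U (proj1_sig s).

(* Product topology on X^X = (X -> X), i.e. topology of pointwise convergence:
   generated by the basic sets {g | g x_k \in V_k for finitely many k}. *)
Definition pw_open {X : Type} (o : (X -> Prop) -> Prop) (W : (X -> X) -> Prop) : Prop :=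
  forall f, W f -> exists l : list (X * (X -> Prop)),
    Forall (fun p => o (snd p) /\ snd p (f (fst p))) l /\
    forall g, Forall (fun p => snd p (g (fst p))) l -> W g.

Definition closure {X : Type} (o : (X -> Prop) -> Prop) (A : X -> Prop) (x : X) : Prop :=
  forall U, o U -> U x -> exists y, A y /\ U y.

Definition compact {X : Type} (o : (X -> Prop) -> Prop) : Prop :=
  forall F : (X -> Prop) -> Prop, (forall U, F U -> o U) ->
    (forall x, exists U, F U /\ U x) ->
    exists l : list (X -> Prop), Forall F l /\ forall x, exists U, In U l /\ U x.

Definition hausdorff {X : Type} (o : (X -> Prop) -> Prop) : Prop :=
  forall x y, x <> y -> exists U V, o U /\ o V /\ U x /\ V y /\
    forall z, U z -> V z -> False.

Definition directed {I : Type} (le : I -> I -> Prop) : Prop :=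
  inhabited I /\ (forall i, le i i) /\
  (forall i j k, le i j -> le j k -> le i k) /\
  (forall i j, exists k, le i k /\ le j k).

Definition net_converges {X I : Type} (o : (X -> Prop) -> Prop)
  (le : I -> I -> Prop) (net : I -> X) (x : X) : Prop :=
  forall U, o U -> U x -> exists i0, forall i, le i0 i -> U (net i).

Definition is_topological_group {G : Type} (o : (G -> Prop) -> Prop)
  (mul : G -> G -> G) (inv : G -> G) (one : G) : Prop :=
  is_topology o /\
  (forall a b c, mul a (mul b c) = mul (mul a b) c) /\
  (forall a, mul one a = a /\ mul a one = a) /\
  (forall a, mul (inv a) a = one /\ mul a (inv a) = one) /\
  continuous (product_open o o) o (fun p => mul (fst p) (snd p)) /\
  continuous o o inv.

Definition is_continuous_action {G X : Type} (oG : (G -> Prop) -> Prop)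
  (oX : (X -> Prop) -> Prop) (mul : G -> G -> G) (one : G)
  (act : G -> X -> X) : Prop :=
  (forall x, act one x = x) /\
  (forall g h x, act (mul g h) x = act g (act h x)) /\
  continuous (product_open oG oX) oX (fun p => act (fst p) (snd p)).

Definition almost_automorphic {G X : Type} (oX : (X -> Prop) -> Prop)
  (inv : G -> G) (act : G -> X -> X) (x : X) : Prop :=
  forall (I : Type) (le : I -> I -> Prop) (t : I -> G) (y : X),
    directed le ->
    net_converges oX le (fun i => act (t i) x) y ->
    net_converges oX le (fun i => act (inv (t i)) y) x.

Definition enveloping {G X : Type} (oX : (X -> Prop) -> Prop)
  (act : G -> X -> X) : (X -> X) -> Prop :=
  closure (pw_open oX) (fun f => exists t, f = act t).

Definition enveloping_is_CH_group {G X : Type} (oX : (X -> Prop) -> Prop)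
  (act : G -> X -> X) : Prop :=
  exists mulE : sig (enveloping oX act) -> sig (enveloping oX act) -> sig (enveloping oX act),
    (forall p q, proj1_sig (mulE p q) = (fun x => proj1_sig p (proj1_sig q x))) /\
    exists (invE : sig (enveloping oX act) -> sig (enveloping oX act))
           (oneE : sig (enveloping oX act)),
      is_topological_group (sub_open (pw_open oX)) mulE invE oneE /\
      compact (sub_open (P := enveloping oX act) (pw_open oX)) /\
      hausdorff (sub_open (P := enveloping oX act) (pw_open oX)).

(* Main.v *)
(* If every point is almost automorphic, then t -> p in E with t in T forces t^-1 -> p^-1
   pointwise. Hence E is a group, and inversion, being continuous along the dense subset T, is
   continuous on E because X is regular. Right multiplications are trivially continuous, so left
   multiplications p q = (q^-1 p^-1)^-1 are too. Joint continuity is then Ellis' theorem for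
   compact groups: a Namioka-type argument gives a nonempty open V such that p |-> (q |-> p q x)
   has small oscillation on V, uniformly in q, and V can be translated to any point of E.
   Conversely, if t_i x -> y, a limit p of the t_i in E satisfies p x = y, and continuity of
   inversion gives t_i^-1 y -> p^-1 y = x. *)

From Stdlib Require Import List Classical ClassicalEpsilon.
From Stdlib Require Import FunctionalExtensionality PropExtensionality ProofIrrelevance.
From mathcomp Require filter.
Require Import Defs.

(** * Ultrafilters and compactness *)

Record ultrafilter {T : Type} (F : (T -> Prop) -> Prop) : Prop := {
  uf_proper : ~ F (fun _ => False);
  uf_and : forall A B, F A -> F B -> F (fun t => A t /\ B t);
  uf_up : forall A B : T -> Prop, F A -> (forall t, A t -> B t) -> F B;
  uf_or : forall A, F A \/ F (fun t => ~ A t) }.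

(** The sets containing a member of [B] form a proper filter, to which the ultrafilter lemma
    applies. In the compactness arguments below, [B] usually consists of the sets of counterexamples
    to a claim, so that a limit along [F] refutes its negation. *)
Lemma ultrafilter_of_base (T : Type) (B : (T -> Prop) -> Prop) :
  (exists S, B S) ->
  (forall S S', B S -> B S' -> exists S'', B S'' /\ forall t, S'' t -> S t /\ S' t) ->
  (forall S, B S -> exists t, S t) ->
  exists F, ultrafilter F /\ forall S, B S -> F S.
Proof.
  intros [S0 HS0] Hdir Hne.
  pose (F0 := fun A : T -> Prop => exists S, B S /\ forall t, S t -> A t).
  assert (PF : filter.ProperFilter F0).
  { constructor.
    - intros [S [HS HSf]]. destruct (Hne S HS) as [t Ht]. exact (HSf t Ht).
    - constructor.
      + exists S0. split; [exact HS0 | intros; exact I].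
      + intros A A' [S [HS HSA]] [S' [HS' HSA']].
        destruct (Hdir S S' HS HS') as [S'' [HS'' Hsub]].
        exists S''. split; [exact HS'' |]. intros t Ht.
        destruct (Hsub t Ht). split; auto.
      + intros A A' HAA' [S [HS HSA]]. exists S. split; [exact HS |].
        intros t Ht. apply HAA', HSA, Ht. }
  destruct (filter.ultraFilterLemma PF) as [F [UF sub]].
  pose proof (filter.ultra_proper (UltraFilter := UF)) as PFF.
  pose proof (filter.filter_filter (ProperFilter := PFF)) as FF.
  exists F. split.
  - constructor.
    + exact (filter.filter_not_empty F).
    + intros A A' HA HA'. exact (filter.filterI HA HA').
    + intros A A' HA HAA'. exact (filter.filterS HAA' HA).
    + intros A. exact (filter.in_ultra_setVsetC A UF).
  - intros S HS. apply sub. exists S. split; auto.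
Qed.

Lemma uf_ex (T : Type) (F : (T -> Prop) -> Prop) (A : T -> Prop) :
  ultrafilter F -> F A -> exists t, A t.
Proof.
  intros HF HA. apply NNPP. intro H. apply (uf_proper F HF).
  apply (uf_up F HF A); [exact HA |]. intros t Ht. apply H. exists t. exact Ht.
Qed.

Lemma uf_Forall (T J : Type) (F : (T -> Prop) -> Prop) (P : J -> T -> Prop) (l : list J) :
  ultrafilter F -> Forall (fun j => F (P j)) l -> F (fun t => Forall (fun j => P j t) l).
Proof.
  intros HF Hl. induction Hl as [| j l Hj Hl IH].
  - destruct (uf_or F HF (fun _ => True)) as [H | H].
    + apply (uf_up F HF _ _ H). intros; constructor.
    + destruct (uf_ex _ _ _ HF H) as [t Ht]. tauto.
  - apply (uf_up F HF _ _ (uf_and F HF _ _ Hj IH)).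
    intros t [H1 H2]. constructor; assumption.
Qed.

Definition limit {T X : Type} (F : (T -> Prop) -> Prop) (o : (X -> Prop) -> Prop)
  (f : T -> X) (x : X) : Prop :=
  forall U, o U -> U x -> F (fun t => U (f t)).

(** If no point were a limit, the open sets with preimage outside [F] would cover [X]. For a finite
    subcover the complements of the preimages all lie in [F], yet their intersection is empty. *)
Lemma compact_limit (T X : Type) (o : (X -> Prop) -> Prop) (F : (T -> Prop) -> Prop)
  (f : T -> X) : compact o -> ultrafilter F -> exists x, limit F o f x.
Proof.
  intros Hc HF. apply NNPP. intro H.
  destruct (Hc (fun U => o U /\ ~ F (fun t => U (f t)))) as [l [Hl Hcov]].
  - tauto.
  - intro x. apply NNPP. intro N. apply H. exists x. intros U oU Ux.
    apply NNPP. intro NF. apply N. exists U. tauto.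
  - assert (K : F (fun t => Forall (fun U : X -> Prop => ~ U (f t)) l)).
    { apply (uf_Forall T _ F (fun (U : X -> Prop) t => ~ U (f t))); [exact HF |].
      eapply Forall_impl; [| exact Hl]. intros U [_ HU].
      destruct (uf_or F HF (fun t => U (f t))); [contradiction | assumption]. }
    destruct (uf_ex _ _ _ HF K) as [t Ht].
    destruct (Hcov (f t)) as [U [HU HUt]].
    exact (proj1 (Forall_forall _ _) Ht U HU HUt).
Qed.

(** For a cover without finite subcover, the complements of its finite unions form a filter base. A
    limit of an ultrafilter above it lies in some member of the cover, whose complement is also in
    the ultrafilter. *)
Lemma compact_of_limits (X : Type) (o : (X -> Prop) -> Prop) :
  (forall F : (X -> Prop) -> Prop, ultrafilter F -> exists x, limit F o (fun t => t) x) ->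
  compact o.
Proof.
  intros Hlim C HCo HCcov. apply NNPP. intro N.
  destruct (ultrafilter_of_base X
    (fun S => exists l, Forall C l /\ S = fun x => Forall (fun U : X -> Prop => ~ U x) l))
    as [F [HF HB]].
  - exists (fun x => Forall (fun U : X -> Prop => ~ U x) nil), nil. auto.
  - intros S S' [l [Hl ->]] [l' [Hl' ->]].
    exists (fun x => Forall (fun U : X -> Prop => ~ U x) (l ++ l')). split.
    + exists (l ++ l'). split; [apply Forall_app; auto | reflexivity].
    + intros t Ht. apply Forall_app in Ht. exact Ht.
  - intros S [l [Hl ->]]. apply NNPP. intro N'. apply N. exists l. split; [exact Hl |].
    intro x. apply NNPP. intro Nx. apply N'. exists x. apply Forall_forall.
    intros U HU HUx. apply Nx. exists U. auto.
  - destruct (Hlim F HF) as [x Hx]. destruct (HCcov x) as [U [CU Ux]].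
    pose proof (Hx U (HCo U CU) Ux) as H1.
    assert (H2 : F (fun x => Forall (fun U : X -> Prop => ~ U x) (U :: nil))).
    { apply HB. exists (U :: nil). split; auto. }
    destruct (uf_ex _ _ _ HF (uf_and F HF _ _ H1 H2)) as [t [Ht1 Ht2]].
    inversion Ht2; auto.
Qed.

Lemma limit_unique (T X : Type) (o : (X -> Prop) -> Prop) (F : (T -> Prop) -> Prop)
  (f : T -> X) (x y : X) :
  hausdorff o -> ultrafilter F -> limit F o f x -> limit F o f y -> x = y.
Proof.
  intros Hh HF Hx Hy. apply NNPP. intro N.
  destruct (Hh x y N) as [U [V [oU [oV [Ux [Vy D]]]]]].
  destruct (uf_ex _ _ _ HF (uf_and F HF _ _ (Hx U oU Ux) (Hy V oV Vy))) as [t [H1 H2]].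
  exact (D _ H1 H2).
Qed.

Lemma limit_continuous (T A B : Type) (oA : (A -> Prop) -> Prop) (oB : (B -> Prop) -> Prop)
  (F : (T -> Prop) -> Prop) (f : T -> A) (h : A -> B) (x : A) :
  continuous oA oB h -> limit F oA f x -> limit F oB (fun t => h (f t)) (h x).
Proof.
  intros Hh Hf U oU Ux. exact (Hf _ (Hh U oU) Ux).
Qed.

(** * Open sets and continuous maps *)

Lemma open_true (X : Type) (o : (X -> Prop) -> Prop) : is_topology o -> o (fun _ => True).
Proof. intros [H _]. exact H. Qed.

Lemma open_and (X : Type) (o : (X -> Prop) -> Prop) (U V : X -> Prop) :
  is_topology o -> o U -> o V -> o (fun x => U x /\ V x).
Proof. intros [_ [H _]]. apply H. Qed.

Lemma open_of_nbhd (X : Type) (o : (X -> Prop) -> Prop) (W : X -> Prop) :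
  is_topology o ->
  (forall x, W x -> exists U, o U /\ U x /\ forall y, U y -> W y) -> o W.
Proof.
  intros [_ [_ Hun]] HW.
  replace W with (fun x => exists U, (o U /\ forall y, U y -> W y) /\ U x).
  - apply Hun. tauto.
  - apply functional_extensionality. intro x. apply propositional_extensionality. split.
    + intros [U [[_ HU] Ux]]. auto.
    + intros Wx. destruct (HW x Wx) as [U [oU [Ux HU]]]. exists U. tauto.
Qed.

Lemma open_Forall (X J : Type) (o : (X -> Prop) -> Prop) (P : J -> X -> Prop) (l : list J) :
  is_topology o -> Forall (fun j => o (P j)) l -> o (fun x => Forall (fun j => P j x) l).
Proof.
  intros Ht Hl. induction Hl as [| j l Hj Hl IH].
  - replace (fun x => Forall (fun j => P j x) nil) with (fun _ : X => True).
    + apply open_true, Ht.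
    + apply functional_extensionality. intro x. apply propositional_extensionality.
      split; auto.
  - replace (fun x => Forall (fun j => P j x) (j :: l))
      with (fun x => P j x /\ Forall (fun j => P j x) l).
    + apply open_and; assumption.
    + apply functional_extensionality. intro x. apply propositional_extensionality.
      symmetry. apply Forall_cons_iff.
Qed.

Lemma continuous_ext (A B : Type) (oA : (A -> Prop) -> Prop) (oB : (B -> Prop) -> Prop)
  (f g : A -> B) : (forall a, f a = g a) -> continuous oA oB f -> continuous oA oB g.
Proof. intros H. apply functional_extensionality in H. subst g. auto. Qed.

Lemma continuous_comp (A B C : Type) (oA : (A -> Prop) -> Prop) (oB : (B -> Prop) -> Prop)
  (oC : (C -> Prop) -> Prop) (f : A -> B) (g : B -> C) :
  continuous oA oB f -> continuous oB oC g -> continuous oA oC (fun a => g (f a)).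
Proof. intros Hf Hg V oV. exact (Hf _ (Hg V oV)). Qed.

(** * Entourages of a compact Hausdorff space *)

(** These are the neighbourhoods of the diagonal, which form the unique uniformity of a compact
    Hausdorff space. *)
Definition entourage {X : Type} (o : (X -> Prop) -> Prop) (D : X -> X -> Prop) : Prop :=
  forall a, exists U, o U /\ U a /\ forall u v, U u -> U v -> D u v.

Section Entourages.

Context (X : Type) (oX : (X -> Prop) -> Prop).
Context (HXt : is_topology oX) (HXc : compact oX) (HXh : hausdorff oX).

(** Otherwise every neighbourhood of [a] has an adherent point outside [U]. An ultrafilter limit [z]
    of such points is still outside [U], hence differs from [a], and disjoint neighbourhoods of [z]
    and [a] give a contradiction. *)
Lemma regular (a : X) (U : X -> Prop) : oX U -> U a ->
  exists V, oX V /\ V a /\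
    forall z, ~ U z -> exists O, oX O /\ O z /\ forall w, O w -> V w -> False.
Proof.
  intros oU Ua. apply NNPP. intro N.
  destruct (ultrafilter_of_base X (fun S => exists V, oX V /\ V a /\
    S = fun z => ~ U z /\ forall O, oX O -> O z -> exists w, O w /\ V w)) as [F [HF HB]].
  - exists (fun z => ~ U z /\ forall O, oX O -> O z -> exists w, O w /\ True), (fun _ => True).
    split; [apply open_true, HXt | split; [exact I | reflexivity]].
  - intros S S' [V [oV [Va ->]]] [V' [oV' [Va' ->]]].
    exists (fun z => ~ U z /\ forall O, oX O -> O z -> exists w, O w /\ (V w /\ V' w)). split.
    + exists (fun w => V w /\ V' w). split; [apply open_and; assumption | split; auto].
    + intros z [Hz HO]. split; (split; [exact Hz |]; intros O oO Oz;
        destruct (HO O oO Oz) as [w Hw]; exists w; tauto).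
  - intros S [V [oV [Va ->]]]. apply NNPP. intro N'. apply N. exists V.
    split; [exact oV | split; [exact Va |]]. intros z Hz. apply NNPP. intro N''.
    apply N'. exists z. split; [exact Hz |]. intros O oO Oz. apply NNPP. intro N3.
    apply N''. exists O. split; [exact oO | split; [exact Oz |]]. intros w Ow Vw.
    apply N3. exists w. auto.
  - destruct (compact_limit X X oX F (fun t => t) HXc HF) as [z Hz].
    assert (NUz : ~ U z).
    { intro Uz. pose proof (Hz U oU Uz) as H1.
      pose proof (HB _ (ex_intro _ U (conj oU (conj Ua eq_refl)))) as H2.
      destruct (uf_ex _ _ _ HF (uf_and F HF _ _ H1 H2)) as [t [H3 [H4 _]]]. auto. }
    destruct (HXh z a) as [O [V [oO [oV [Oz [Va D]]]]]]; [intros ->; auto |].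
    pose proof (HB _ (ex_intro _ V (conj oV (conj Va eq_refl)))) as H2.
    destruct (uf_ex _ _ _ HF (uf_and F HF _ _ (Hz O oO Oz) H2)) as [t [Ot [_ Ht]]].
    destruct (Ht O oO Ot) as [w [Ow Vw]]. exact (D w Ow Vw).
Qed.

Lemma entourage_and (D D' : X -> X -> Prop) : entourage oX D -> entourage oX D' ->
  entourage oX (fun a b => D a b /\ D' a b).
Proof.
  intros H H' a. destruct (H a) as [U [oU [Ua HU]]]. destruct (H' a) as [U' [oU' [Ua' HU']]].
  exists (fun x => U x /\ U' x). split; [apply open_and; assumption | split; [auto |]].
  intros u v [] []. auto.
Qed.

Lemma entourage_flip (D : X -> X -> Prop) : entourage oX D ->
  entourage oX (fun a b => D b a).
Proof.
  intros H a. destruct (H a) as [U [oU [Ua HU]]]. exists U. auto.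
Qed.

(** If every [D] had a counterexample [(a, b, c)], these triples would have coordinatewise limits
    along an ultrafilter. The three limits agree because entourages separate points, and [W]
    contains a square around the common limit. *)
Lemma entourage_half (W : X -> X -> Prop) : entourage oX W ->
  exists D, entourage oX D /\ forall a b c, D a b -> D b c -> W a c.
Proof.
  intros HW. apply NNPP. intro N.
  destruct (ultrafilter_of_base (X * X * X) (fun S => exists D, entourage oX D /\
    S = fun t => D (fst (fst t)) (snd (fst t)) /\ D (snd (fst t)) (snd t) /\
                 ~ W (fst (fst t)) (snd t))) as [F [HF HB]].
  - eexists. exists W. split; [exact HW | reflexivity].
  - intros S S' [D [HD ->]] [D' [HD' ->]]. eexists. split.
    + exists (fun a b => D a b /\ D' a b).
      split; [apply entourage_and; assumption | reflexivity].
    + simpl. tauto.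
  - intros S [D [HD ->]]. apply NNPP. intro N'. apply N. exists D. split; [exact HD |].
    intros a b c Hab Hbc. apply NNPP. intro N''. apply N'. exists (a, b, c). simpl. tauto.
  - destruct (compact_limit _ X oX F (fun t => fst (fst t)) HXc HF) as [a Ha].
    destruct (compact_limit _ X oX F (fun t => snd (fst t)) HXc HF) as [b Hb].
    destruct (compact_limit _ X oX F snd HXc HF) as [c Hc].
    assert (sep : forall f g : X * X * X -> X, forall x y : X,
      limit F oX f x -> limit F oX g y ->
      (forall D, entourage oX D -> F (fun t => D (f t) (g t))) -> x = y).
    { intros f g x y Hx Hy HD. apply NNPP. intro Nxy.
      destruct (HXh x y Nxy) as [A [B [oA [oB [Ax [By dis]]]]]].
      destruct (regular x A oA Ax) as [A' [oA' [Ax' HA']]].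
      (* Removing the product of [A'] and [B] leaves a neighbourhood of the diagonal: a point of [A]
         has the neighbourhood [A], disjoint from [B], and any other point has one disjoint from
         [A']. *)
      assert (ent : entourage oX (fun u v => ~ (A' u /\ B v))).
      { intro z. destruct (classic (A z)) as [Az | Az].
        - exists A. split; [exact oA | split; [exact Az |]].
          intros u v _ Av [_ Bv]. exact (dis v Av Bv).
        - destruct (HA' z Az) as [O [oO [Oz HO]]]. exists O.
          split; [exact oO | split; [exact Oz |]]. intros u v Ou _ [Au _]. exact (HO u Ou Au). }
      destruct (uf_ex _ _ _ HF (uf_and F HF _ _ (HD _ ent)
        (uf_and F HF _ _ (Hx A' oA' Ax') (Hy B oB By)))) as [t [H1 H2]]. exact (H1 H2). }
    assert (Eab : a = b).
    { apply (sep _ _ _ _ Ha Hb). intros D HD.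
      apply (uf_up F HF _ _ (HB _ (ex_intro _ D (conj HD eq_refl)))). simpl. tauto. }
    assert (Ebc : b = c).
    { apply (sep _ _ _ _ Hb Hc). intros D HD.
      apply (uf_up F HF _ _ (HB _ (ex_intro _ D (conj HD eq_refl)))). simpl. tauto. }
    subst b c. destruct (HW a) as [U [oU [Ua HU]]].
    pose proof (HB _ (ex_intro _ W (conj HW eq_refl))) as H.
    destruct (uf_ex _ _ _ HF (uf_and F HF _ _ H (uf_and F HF _ _ (Ha U oU Ua) (Hc U oU Ua))))
      as [t [[_ [_ H1]] [H2 H3]]]. apply H1, HU; assumption.
Qed.

Lemma entourage_refl (D : X -> X -> Prop) (a : X) : entourage oX D -> D a a.
Proof. intros H. destruct (H a) as [U [_ [Ua HU]]]. auto. Qed.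

(** Three steps and symmetry are what is needed to move both ends of a close pair. Halving twice
    would allow four steps; the last one is filled by a diagonal pair. *)
Lemma entourage_third (W : X -> X -> Prop) : entourage oX W ->
  exists D, entourage oX D /\ (forall a b, D a b -> D b a) /\
    forall a b c d, D a b -> D b c -> D c d -> W a d.
Proof.
  intros HW. destruct (entourage_half W HW) as [D1 [HD1 H1]].
  destruct (entourage_half D1 HD1) as [D2 [HD2 H2]].
  exists (fun a b => D2 a b /\ D2 b a). split; [| split].
  - apply entourage_and; [| apply entourage_flip]; exact HD2.
  - tauto.
  - intros a b c d [Hab _] [Hbc _] [Hcd _]. apply (H1 a c d).
    + exact (H2 a b c Hab Hbc).
    + apply (H2 c d d Hcd), entourage_refl, HD2.
Qed.

Lemma entourage_nbhd (U : X -> Prop) (x : X) : oX U -> U x ->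
  exists D, entourage oX D /\ forall y, D x y -> U y.
Proof.
  intros oU Ux. destruct (regular x U oU Ux) as [V [oV [Vx HV]]].
  (* Near a point of [U] the conclusion of the implication holds; near any other point regularity
     makes its premise fail. *)
  exists (fun a b => V a -> U b). split; [| auto].
  intro z. destruct (classic (U z)) as [Uz | NUz].
  - exists U. auto.
  - destruct (HV z NUz) as [O [oO [Oz HO]]]. exists O. split; [exact oO | split; [exact Oz |]].
    intros u v Ou _ Vu. destruct (HO u Ou Vu).
Qed.

Lemma limit_entourage (T : Type) (F : (T -> Prop) -> Prop) (f : T -> X) (x : X)
  (D : X -> X -> Prop) : ultrafilter F -> limit F oX f x -> entourage oX D ->
  F (fun t => D x (f t)).
Proof.
  intros HF Hf HD. destruct (HD x) as [U [oU [Ux HU]]].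
  apply (uf_up F HF _ _ (Hf U oU Ux)). auto.
Qed.

End Entourages.

(** * Separately continuous maps *)

Section Separate.

Context (X : Type) (oX : (X -> Prop) -> Prop).
Context (HXt : is_topology oX) (HXc : compact oX) (HXh : hausdorff oX).

Lemma near_list (A J : Type) (oA : (A -> Prop) -> Prop) (f : J -> A -> X) (a : A)
  (l : list J) (D : X -> X -> Prop) :
  is_topology oA -> (forall j, continuous oA oX (f j)) -> entourage oX D ->
  exists U, oA U /\ U a /\
    forall u v, U u -> U v -> forall j, In j l -> D (f j u) (f j v).
Proof.
  intros HA Hf HD. induction l as [| j l [U [oU [Ua HU]]]].
  - exists (fun _ => True). split; [apply open_true, HA | split; [exact I |]].
    intros u v _ _ j [].
  - destruct (HD (f j a)) as [V [oV [Va HV]]].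
    exists (fun x => V (f j x) /\ U x). split; [| split].
    + apply open_and; [exact HA | exact (Hf j V oV) | exact oU].
    + auto.
    + intros u v [Vu Uu] [Vv Uv] i [<- | Hi]; auto.
Qed.

(** This is total boundedness: the open sets on which all [f j] with [j] in [l] vary within [D]
    cover [L], and one point is kept for each member of a finite subcover. *)
Lemma finite_net (L J : Type) (oL : (L -> Prop) -> Prop) (f : J -> L -> X)
  (l : list J) (D : X -> X -> Prop) :
  is_topology oL -> compact oL -> (forall j, continuous oL oX (f j)) -> entourage oX D ->
  exists ys, forall q, exists q', In q' ys /\ forall j, In j l -> D (f j q) (f j q').
Proof.
  intros HL HLc Hf HD.
  pose (C := fun U => oL U /\
    exists q', forall q, U q -> forall j, In j l -> D (f j q) (f j q')).
  destruct (HLc C) as [lU [HlU Hcov]].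
  - intros U [oU _]. exact oU.
  - intro q. destruct (near_list L J oL f q l D HL Hf HD) as [U [oU [Uq HU]]].
    exists U. split; [| exact Uq]. split; [exact oU |]. exists q. intros p Up. apply HU; assumption.
  - assert (Hys : exists ys, forall U, In U lU -> exists q', In q' ys /\
      forall q, U q -> forall j, In j l -> D (f j q) (f j q')).
    { clear Hcov. induction HlU as [| U lU [_ [q' Hq']] HlU [ys IH]].
      - exists nil. intros U [].
      - exists (q' :: ys). intros U' [<- | HU'].
        + exists q'. split; [left; reflexivity | exact Hq'].
        + destruct (IH U' HU') as [q'' [Hin Hq'']]. exists q''.
          split; [right; exact Hin | exact Hq'']. }
    destruct Hys as [ys Hys]. exists ys. intro q. destruct (Hcov q) as [U [HU Uq]].
    destruct (Hys U HU) as [q' [Hin Hq']]. exists q'. auto.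
Qed.

Context (K L : Type) (oK : (K -> Prop) -> Prop) (oL : (L -> Prop) -> Prop).
Context (HKt : is_topology oK) (HKc : compact oK) (HLt : is_topology oL) (HLc : compact oL).
Context (F : K -> L -> X).
Context (HFl : forall q, continuous oK oX (fun p => F p q)).
Context (HFr : forall p, continuous oL oX (F p)).

(** Fix a finite net [ys] for the maps [F j], then shrink [V] until each [F p y] with [y] in [ys]
    barely depends on [p]. Large oscillation on the smaller set gives [g], [g'], [q]; with [q'] in
    the net close to [q], one of [F g], [F g'] must separate [q] from [q'], and this persists near
    that point. *)
Lemma oscillation_step (D D1 D2 D' : X -> X -> Prop) :
  entourage oX D1 -> (forall a b, D1 a b -> D1 b a) ->
  (forall a b c d, D1 a b -> D1 b c -> D1 c d -> D a d) ->
  entourage oX D2 -> (forall a b, D2 a b -> D2 b a) ->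
  (forall a b c d, D2 a b -> D2 b c -> D2 c d -> D1 a d) ->
  entourage oX D' ->
  (forall V, oK V -> (exists v, V v) ->
     exists g g' q, V g /\ V g' /\ ~ D (F g q) (F g' q)) ->
  forall V l, oK V -> (exists v, V v) ->
  exists V' h q q', oK V' /\ V' h /\ (forall v, V' v -> V v) /\
    (forall j, In j l -> D' (F j q) (F j q')) /\
    (forall k, V' k -> ~ D2 (F k q) (F k q')).
Proof.
  intros HD1 S1 T1 HD2 S2 T2 HD' N V l oV [v Vv].
  destruct (finite_net L K oL F l
    D' HLt HLc HFr HD') as [ys Hys].
  destruct (near_list K L oK (fun q p => F p q) v ys D1 HKt HFl HD1) as [W [oW [Wv HW]]].
  destruct (N (fun k => V k /\ W k)) as [g [g' [q [[Vg Wg] [[Vg' Wg'] Hgg']]]]].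
  { apply open_and; assumption. }
  { exists v. auto. }
  destruct (Hys q) as [q' [Hin Hq']].
  assert (Hh : exists h, V h /\ ~ D1 (F h q) (F h q')).
  { apply NNPP. intro N'. apply Hgg'. apply (T1 _ (F g q') (F g' q')).
    - apply NNPP. intro H. apply N'. exists g. auto.
    - apply HW; assumption.
    - apply S1. apply NNPP. intro H. apply N'. exists g'. auto. }
  destruct Hh as [h [Vh Hh]].
  destruct (near_list K L oK (fun q p => F p q) h (q :: q' :: nil) D2 HKt HFl HD2)
    as [O [oO [Oh HO]]].
  exists (fun k => V k /\ O k), h, q, q'. split; [apply open_and; assumption |].
  split; [auto |]. split; [tauto |]. split; [exact Hq' |].
  intros k [_ Ok] HDk. apply Hh. apply (T2 _ (F k q) (F k q')).
  - apply HO; simpl; auto.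
  - exact HDk.
  - apply HO; simpl; auto.
Qed.

(* A Namioka-type statement. If it failed, one could choose decreasing open sets V_n, points
   h_n in V_n and pairs (q_n, q'_n) that F h_j does not separate for j <= n, but that every F k
   with k in V_(n+1) does. In the limit (h_n, q_n, q'_n) -> (g, q, q'), F g separates q and q'
   although no F h_j does, which contradicts h_j -> g. *)
Lemma small_oscillation (k0 : K) (D : X -> X -> Prop) : entourage oX D ->
  exists V, oK V /\ (exists v, V v) /\
    forall g g', V g -> V g' -> forall q, D (F g q) (F g' q).
Proof.
  intros HD. apply NNPP. intro N.
  (* One entourage is spent on each approximation: [D1], [D2] inside [oscillation_step], [D3] and
     [D4] in passing to the limit with the separated pairs, [D6] and [D5] with the unseparated
     ones. *)
  destruct (entourage_third X oX HXt HXc HXh D HD) as [D1 [HD1 [S1 T1]]].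
  destruct (entourage_third X oX HXt HXc HXh D1 HD1) as [D2 [HD2 [S2 T2]]].
  destruct (entourage_third X oX HXt HXc HXh D2 HD2) as [D3 [HD3 [S3 T3]]].
  destruct (entourage_third X oX HXt HXc HXh D3 HD3) as [D4 [HD4 [S4 T4]]].
  destruct (entourage_third X oX HXt HXc HXh D4 HD4) as [D5 [HD5 [S5 T5]]].
  destruct (entourage_third X oX HXt HXc HXh D5 HD5) as [D6 [HD6 [S6 T6]]].
  assert (N' : forall V, oK V -> (exists v, V v) ->
     exists g g' q, V g /\ V g' /\ ~ D (F g q) (F g' q)).
  { intros V oV HV. apply NNPP. intro H. apply N. exists V.
    split; [exact oV | split; [exact HV |]]. intros g g' Vg Vg' q. apply NNPP. intro H'.
    apply H. exists g, g', q. auto. }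
  pose proof (oscillation_step D D1 D2 D6 HD1 S1 T1 HD2 S2 T2 HD6 N') as step.
  pose (St := ((K -> Prop) * list K * K * L * L)%type).
  pose (V_ := fun s : St => fst (fst (fst (fst s)))).
  pose (l_ := fun s : St => snd (fst (fst (fst s)))).
  pose (h_ := fun s : St => snd (fst (fst s))).
  pose (q_ := fun s : St => snd (fst s)).
  pose (r_ := fun s : St => snd s).
  pose (ok := fun s : St => oK (V_ s) /\ V_ s (h_ s)).
  pose (R := fun s s' : St => ok s' /\ (forall v, V_ s' v -> V_ s v) /\
    l_ s' = h_ s' :: l_ s /\
    (forall j, In j (l_ s) -> D6 (F j (q_ s')) (F j (r_ s'))) /\
    (forall k, V_ s' k -> ~ D2 (F k (q_ s')) (F k (r_ s')))).
  (* The condition [ok s] sits under the existential, so that [nxt] is a total function on states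
     and can be iterated. *)
  assert (Hstep : forall s, exists s', ok s -> R s s').
  { intro s. destruct (classic (ok s)) as [[os Vs] | Ns].
    - destruct (step (V_ s) (l_ s) os (ex_intro _ _ Vs))
        as [V' [h [q [q' [oV' [V'h [sub [H1 H2]]]]]]]].
      exists (V', h :: l_ s, h, q, q'). intros _. unfold R, ok. simpl. auto.
    - exists s. contradiction. }
  pose (nxt := fun s => proj1_sig (constructive_indefinite_description _ (Hstep s))).
  assert (Hnxt : forall s, ok s -> R s (nxt s)).
  { intro s. exact (proj2_sig (constructive_indefinite_description _ (Hstep s))). }
  assert (l0 : inhabited L).
  { destruct (N' (fun _ => True)) as [_ [_ [q _]]];
      [apply open_true, HKt | exists k0; exact I | exact (inhabits q)]. }
  destruct l0 as [l0].
  pose (s := fun n => nat_rect (fun _ => St) ((fun _ => True), k0 :: nil, k0, l0, l0)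
                        (fun _ => nxt) n).
  assert (Hok : forall n, ok (s n)).
  { induction n as [| n IH].
    - exact (conj (open_true K oK HKt) I).
    - exact (proj1 (Hnxt _ IH)). }
  assert (HR : forall n, R (s n) (s (S n))) by (intro n; apply (Hnxt _ (Hok n))).
  assert (HV : forall n m, n <= m -> forall v, V_ (s m) v -> V_ (s n) v).
  { intros n m Hnm. induction Hnm as [| m Hnm IH]; [auto |].
    intros v Hv. apply IH. exact (proj1 (proj2 (HR m)) v Hv). }
  assert (Hl : forall n m, n <= m -> In (h_ (s n)) (l_ (s m))).
  { intros n m Hnm. induction Hnm as [| m Hnm IH].
    - destruct n as [| n]; [left; reflexivity |].
      rewrite (proj1 (proj2 (proj2 (HR n)))). left. reflexivity.
    - rewrite (proj1 (proj2 (proj2 (HR m)))). right. exact IH. }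
  (* The dummy pair [(l0, l0)] of stage 0 is skipped by the shift: pair [n] is chosen in passing
     from stage [n] to stage [n + 1], hence is close under [h 0], ..., [h n] and separated under
     every later [h m]. *)
  pose (h := fun n => h_ (s n)). pose (q := fun n => q_ (s (S n))).
  pose (r := fun n => r_ (s (S n))).
  assert (P1 : forall j n, j <= n -> D6 (F (h j) (q n)) (F (h j) (r n))).
  { intros j n Hjn. apply (HR n). apply Hl, Hjn. }
  assert (P2 : forall m n, S n <= m -> ~ D2 (F (h m) (q n)) (F (h m) (r n))).
  { intros m n Hnm. apply (HR n). apply (HV _ m Hnm). apply Hok. }
  clearbody h q r.
  destruct (ultrafilter_of_base nat (fun A => exists n, A = fun m => n <= m))
    as [w [Hw HB]].
  { exists (fun m => 0 <= m), 0. reflexivity. }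
  { intros A A' [n ->] [n' ->]. exists (fun m => n + n' <= m).
    split; [exists (n + n'); reflexivity |]. intros t Ht. split;
      (eapply PeanoNat.Nat.le_trans; [| exact Ht]);
      [apply PeanoNat.Nat.le_add_r | apply PeanoNat.Nat.le_add_l]. }
  { intros A [n ->]. exists n. constructor. }
  assert (tail : forall n, w (fun m => n <= m)) by (intro n; apply HB; exists n; reflexivity).
  destruct (compact_limit nat K oK w h HKc Hw) as [g Hg].
  destruct (compact_limit nat L oL w q HLc Hw) as [q0 Hq].
  destruct (compact_limit nat L oL w r HLc Hw) as [r0 Hr].
  assert (near_g : forall D y, entourage oX D -> w (fun m => D (F g y) (F (h m) y))).
  { intros E y HE. apply (limit_entourage X oX nat w); [exact Hw | | exact HE].
    exact (limit_continuous _ _ _ _ _ w h (fun p => F p y) g (HFl y) Hg). }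
  assert (near_q : forall D k, entourage oX D ->
    w (fun n => D (F k q0) (F k (q n)) /\ D (F k r0) (F k (r n)))).
  { intros E k HE. apply (uf_and w Hw);
      (apply (limit_entourage X oX nat w); [exact Hw | | exact HE]).
    - exact (limit_continuous _ _ _ _ _ w q (F k) q0 (HFr k) Hq).
    - exact (limit_continuous _ _ _ _ _ w r (F k) r0 (HFr k) Hr). }
  (* Two iterated limits are compared. Taking [m] to the limit and then [n] keeps the pair separated
     under [g] ([Q3], [Q4]); taking [n] first with [j] fixed keeps it close under [h j] ([Q5]),
     hence under [g]. *)
  assert (Q3 : forall n, ~ D3 (F g (q n)) (F g (r n))).
  { intros n H.
    destruct (uf_ex _ _ _ Hw (uf_and w Hw _ _ (tail (S n))
      (uf_and w Hw _ _ (near_g D3 (q n) HD3) (near_g D3 (r n) HD3)))) as [m [Hm [H1 H2]]].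
    apply (P2 m n Hm). exact (T3 _ _ _ _ (S3 _ _ H1) H H2). }
  assert (Q4 : ~ D4 (F g q0) (F g r0)).
  { intro H. destruct (uf_ex _ _ _ Hw (near_q D4 g HD4)) as [n [H1 H2]].
    apply (Q3 n). exact (T4 _ _ _ _ (S4 _ _ H1) H H2). }
  assert (Q5 : forall j, D5 (F (h j) q0) (F (h j) r0)).
  { intro j. destruct (uf_ex _ _ _ Hw (uf_and w Hw _ _ (tail j) (near_q D6 (h j) HD6)))
      as [n [Hn [H1 H2]]].
    exact (T6 _ _ _ _ H1 (P1 j n Hn) (S6 _ _ H2)). }
  destruct (uf_ex _ _ _ Hw (uf_and w Hw _ _ (near_g D5 q0 HD5) (near_g D5 r0 HD5)))
    as [m [H1 H2]].
  apply Q4. exact (T5 _ _ _ _ H1 (Q5 m) (S5 _ _ H2)).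
Qed.

End Separate.

(** * The topology of pointwise convergence *)

Lemma pw_topology (X : Type) (o : (X -> Prop) -> Prop) : is_topology (pw_open o).
Proof.
  split; [| split].
  - intros f _. exists nil. auto.
  - intros U V HU HV f [Uf Vf].
    destruct (HU f Uf) as [l [Hl Hl']]. destruct (HV f Vf) as [m [Hm Hm']].
    exists (l ++ m). split; [apply Forall_app; auto |].
    intros g Hg. apply Forall_app in Hg. destruct Hg. auto.
  - intros C HC f [U [CU Uf]]. destruct (HC U CU f Uf) as [l [Hl Hl']].
    exists l. split; [exact Hl |]. intros g Hg. exists U. auto.
Qed.

Lemma sub_topology (X : Type) (P : X -> Prop) (o : (X -> Prop) -> Prop) :
  is_topology o -> is_topology (sub_open (P := P) o).
Proof.
  intros [HT [HI HU]]. split; [| split].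
  - exists (fun _ => True). tauto.
  - intros W W' [U [oU H]] [U' [oU' H']]. exists (fun x => U x /\ U' x).
    split; [auto |]. intro s. rewrite H, H'. tauto.
  - intros C HC.
    exists (fun x => exists U, (o U /\ exists W, C W /\ forall s, W s <-> U (proj1_sig s)) /\ U x).
    split; [apply HU; tauto |]. intro s. split.
    + intros [W [CW Ws]]. destruct (HC W CW) as [U [oU H]]. exists U.
      split; [split; [exact oU | exists W; auto] | apply H, Ws].
    + intros [U [[oU [W [CW H]]] Us]]. exists W. split; [exact CW | apply H, Us].
Qed.

Lemma product_topology (A B : Type) (oA : (A -> Prop) -> Prop) (oB : (B -> Prop) -> Prop) :
  is_topology oA -> is_topology oB -> is_topology (product_open oA oB).
Proof.
  intros HA HB. split; [| split].
  - intros p _. exists (fun _ => True), (fun _ => True).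
    repeat split; apply open_true; assumption.
  - intros W W' HW HW' p [Wp Wp'].
    destruct (HW p Wp) as [U [V [oU [oV [Up [Vp H]]]]]].
    destruct (HW' p Wp') as [U' [V' [oU' [oV' [Up' [Vp' H']]]]]].
    exists (fun a => U a /\ U' a), (fun b => V b /\ V' b).
    split; [apply open_and; assumption | split; [apply open_and; assumption |]].
    split; [auto | split; [auto |]]. intros q [] []. auto.
  - intros C HC p [W [CW Wp]]. destruct (HC W CW p Wp) as [U [V [oU [oV [Up [Vp H]]]]]].
    exists U, V. repeat split; auto. intros q Uq Vq. exists W. auto.
Qed.

Section Pointwise.

Context (X : Type) (oX : (X -> Prop) -> Prop) (P : (X -> X) -> Prop).

Let oP := sub_open (P := P) (pw_open oX).

Lemma eval_open (x : X) (U : X -> Prop) : oX U -> pw_open oX (fun f => U (f x)).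
Proof.
  intros oU f Uf. exists ((x, U) :: nil). split.
  - constructor; [auto | constructor].
  - intros g Hg. inversion Hg; assumption.
Qed.

Lemma eval_continuous (x : X) : continuous oP oX (fun p => proj1_sig p x).
Proof.
  intros U oU. exists (fun f => U (f x)). split; [apply eval_open, oU | reflexivity].
Qed.

Lemma pointwise_continuous (A : Type) (oA : (A -> Prop) -> Prop) (f : A -> sig P) :
  is_topology oA -> (forall x, continuous oA oX (fun a => proj1_sig (f a) x)) ->
  continuous oA oP f.
Proof.
  intros HA Hf W [U [oU H]]. apply open_of_nbhd; [exact HA |].
  intros a Wa. apply H in Wa. destruct (oU _ Wa) as [l [Hl Hl']].
  exists (fun b => Forall (fun p => snd p (proj1_sig (f b) (fst p))) l).
  split; [| split].
  - apply (open_Forall A _ oA (fun p b => snd p (proj1_sig (f b) (fst p)))); [exact HA |].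
    eapply Forall_impl; [| exact Hl]. intros p [op _]. exact (Hf (fst p) (snd p) op).
  - eapply Forall_impl; [| exact Hl]. intros p [_ Hp]. exact Hp.
  - intros b Hb. apply H, Hl', Hb.
Qed.

Lemma limit_pw_open (T : Type) (F : (T -> Prop) -> Prop) (f : T -> X -> X) (g : X -> X) :
  ultrafilter F -> (forall x, limit F oX (fun t => f t x) (g x)) ->
  limit F (pw_open oX) f g.
Proof.
  intros HF Hf U oU Ug. destruct (oU g Ug) as [l [Hl Hl']].
  apply (uf_up F HF (fun t => Forall (fun p => snd p (f t (fst p))) l)); [| auto].
  apply (uf_Forall T _ F (fun p t => snd p (f t (fst p)))); [exact HF |].
  eapply Forall_impl; [| exact Hl]. intros p [op Hp]. exact (Hf (fst p) (snd p) op Hp).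
Qed.

Lemma hausdorff_pointwise : hausdorff oX -> hausdorff oP.
Proof.
  intros Hh p q Npq.
  assert (Hx : exists x, proj1_sig p x <> proj1_sig q x).
  { apply NNPP. intro N. apply Npq. destruct p as [p Hp], q as [q Hq]. simpl in N.
    apply subset_eq_compat. apply functional_extensionality. intro x.
    apply NNPP. intro Nx. apply N. exists x. exact Nx. }
  destruct Hx as [x Hx]. destruct (Hh _ _ Hx) as [U [V [oU [oV [Ux [Vx dis]]]]]].
  exists (fun s => U (proj1_sig s x)), (fun s => V (proj1_sig s x)).
  split; [apply eval_continuous, oU | split; [apply eval_continuous, oV |]].
  split; [exact Ux | split; [exact Vx |]]. intros s. apply dis.
Qed.

End Pointwise.

(** * The enveloping semigroup *)

Section Flow.

Context (G : Type) (oG : (G -> Prop) -> Prop).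
Context (mul : G -> G -> G) (inv : G -> G) (one : G).
Context (HG : is_topological_group oG mul inv one).
Context (X : Type) (oX : (X -> Prop) -> Prop).
Context (HXt : is_topology oX) (HXc : compact oX) (HXh : hausdorff oX).
Context (act : G -> X -> X) (Hact : is_continuous_action oG oX mul one act).

Let E := sig (enveloping oX act).
Let oE := sub_open (P := enveloping oX act) (pw_open oX).

Lemma enveloping_topology : is_topology oE.
Proof. apply sub_topology, pw_topology. Qed.

Lemma act_one (x : X) : act one x = x.
Proof. apply Hact. Qed.

Lemma act_inv_r (g : G) (x : X) : act g (act (inv g) x) = x.
Proof.
  destruct Hact as [H1 [Hm _]]. destruct HG as [_ [_ [_ [Hi _]]]].
  rewrite <- Hm, (proj2 (Hi g)). apply H1.
Qed.

Lemma act_continuous (g : G) : continuous oX oX (act g).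
Proof.
  intros V oV. destruct Hact as [_ [_ Hc]]. apply open_of_nbhd; [exact HXt |].
  intros x Vx. destruct (Hc V oV (g, x) Vx) as [U [U' [oU [oU' [Ug [Ux H]]]]]].
  exists U'. split; [exact oU' | split; [exact Ux |]]. intros y Uy. exact (H (g, y) Ug Uy).
Qed.

Lemma enveloping_act (t : G) : enveloping oX act (act t).
Proof. intros U _ Ut. exists (act t). split; [exists t; reflexivity | exact Ut]. Qed.

Definition translation (t : G) : E := exist _ (act t) (enveloping_act t).

Lemma enveloping_meets (p : X -> X) (W : (X -> X) -> Prop) :
  enveloping oX act p -> pw_open oX W -> W p -> exists t, W (act t).
Proof.
  intros Hp oW Wp. destruct (Hp W oW Wp) as [f [[t ->] Wt]]. exists t. exact Wt.
Qed.

(** The order of approximation matters since [p] need not be continuous: first [p] is replaced by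
    some [act t] at the finitely many points [q x], then continuity of [act t] allows replacing [q]
    by some [act u]. *)
Lemma enveloping_comp (p q : X -> X) :
  enveloping oX act p -> enveloping oX act q -> enveloping oX act (fun x => p (q x)).
Proof.
  intros Hp Hq W oW Wpq. destruct (oW _ Wpq) as [l [Hl Hl']].
  destruct (enveloping_meets p (fun f => Forall (fun c => snd c (f (q (fst c)))) l) Hp)
    as [t Ht].
  { apply (open_Forall _ _ (pw_open oX) (fun c f => snd c (f (q (fst c)))));
      [apply pw_topology |].
    eapply Forall_impl; [| exact Hl]. intros c [oc _]. apply eval_open, oc. }
  { eapply Forall_impl; [| exact Hl]. intros c [_ Hc]. exact Hc. }
  destruct (enveloping_meets q (fun f => Forall (fun c => snd c (act t (f (fst c)))) l) Hq)
    as [u Hu].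
  { apply (open_Forall _ _ (pw_open oX) (fun c f => snd c (act t (f (fst c)))));
      [apply pw_topology |].
    eapply Forall_impl; [| exact Hl]. intros c [oc _].
    apply (eval_open X oX (fst c) (fun y => snd c (act t y))).
    exact (act_continuous t _ oc). }
  { exact Ht. }
  exists (act (mul t u)). split; [exists (mul t u); reflexivity |].
  apply Hl'. eapply Forall_impl; [| exact Hu]. intros c Hc. simpl in Hc.
  destruct Hact as [_ [Hm _]]. rewrite Hm. exact Hc.
Qed.

(** As in Tychonoff's theorem, limits are chosen at each point of [X]; the resulting map lies in the
    closure because the closure is closed. *)
Lemma enveloping_limit (T : Type) (F : (T -> Prop) -> Prop) (f : T -> E) :
  ultrafilter F -> exists p, limit F oE f p.
Proof.
  intros HF.
  assert (Hlim : forall x, exists y, limit F oX (fun t => proj1_sig (f t) x) y).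
  { intro x. apply compact_limit; assumption. }
  pose (g := fun x => proj1_sig (constructive_indefinite_description _ (Hlim x))).
  assert (Hg : limit F (pw_open oX) (fun t => proj1_sig (f t)) g).
  { apply limit_pw_open; [exact HF |]. intro x.
    exact (proj2_sig (constructive_indefinite_description _ (Hlim x))). }
  assert (Eg : enveloping oX act g).
  { intros U oU Ug. destruct (uf_ex _ _ _ HF (Hg U oU Ug)) as [t Ht].
    exact (proj2_sig (f t) U oU Ht). }
  exists (exist _ g Eg). intros W [U [oU H]] Wg. apply H in Wg.
  apply (uf_up F HF _ _ (Hg U oU Wg)). intros t Ht. apply H, Ht.
Qed.

Lemma enveloping_compact : compact oE.
Proof. apply compact_of_limits. intros F HF. apply enveloping_limit, HF. Qed.

Lemma enveloping_group_almost_automorphic :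
  enveloping_is_CH_group oX act -> forall x, almost_automorphic oX inv act x.
Proof.
  intros [mulE [HmE [invE [oneE [[_ [_ [H1 [Hi [_ Hci]]]]] _]]]]].
  (* [oneE] is only known to be a unit for [mulE]; multiplying it with the translation by [one]
     shows that it is the identity map. *)
  assert (one_id : forall z, proj1_sig oneE z = z).
  { intro z. pose proof (f_equal (fun p => proj1_sig p z) (proj1 (H1 (translation one)))) as H.
    cbv beta in H. rewrite HmE in H. simpl in H. rewrite act_one in H. exact H. }
  assert (invK : forall a z, proj1_sig (invE a) (proj1_sig a z) = z).
  { intros a z. pose proof (f_equal (fun p => proj1_sig p z) (proj1 (Hi a))) as H.
    cbv beta in H. rewrite HmE in H. rewrite H. apply one_id. }
  intros x J le t y [[j0] [Hrefl [Htr Hdir]]] Hconv U oU Ux. apply NNPP. intro N.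
  (* The base consists of tails of the net restricted to the indices that violate convergence into
     [U], so [F] plays the role of a bad subnet. *)
  destruct (ultrafilter_of_base J
    (fun S => exists i0, S = fun i => le i0 i /\ ~ U (act (inv (t i)) y))) as [F [HF HB]].
  - exists (fun i => le j0 i /\ ~ U (act (inv (t i)) y)), j0. reflexivity.
  - intros S S' [i ->] [i' ->]. destruct (Hdir i i') as [k [Hk Hk']].
    exists (fun j => le k j /\ ~ U (act (inv (t j)) y)). split; [exists k; reflexivity |].
    intros j [Hj Hj']. split; (split; [| exact Hj']); eauto.
  - intros S [i ->]. apply NNPP. intro N'. apply N. exists i. intros j Hj.
    apply NNPP. intro N''. apply N'. exists j. auto.
  - destruct (enveloping_limit J F (fun i => translation (t i)) HF) as [p Hp].
    assert (Epx : proj1_sig p x = y).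
    { apply (limit_unique J X oX F (fun i => act (t i) x)); [exact HXh | exact HF | |].
      - exact (limit_continuous _ _ _ _ _ F _ _ p (eval_continuous X oX _ x) Hp).
      - intros V oV Vy. destruct (Hconv V oV Vy) as [i Hi'].
        apply (uf_up F HF _ _ (HB _ (ex_intro _ i eq_refl))). intros j [Hj _]. auto. }
    pose proof (limit_continuous _ _ _ _ _ F _ _ _ (eval_continuous X oX _ y)
      (limit_continuous _ _ _ _ _ F _ _ p Hci Hp)) as Hlim.
    assert (Einv : proj1_sig (invE p) y = x) by (rewrite <- Epx; apply invK).
    cbv beta in Hlim. rewrite Einv in Hlim.
    pose proof (HB _ (ex_intro _ j0 eq_refl)) as HN.
    destruct (uf_ex _ _ _ HF (uf_and F HF _ _ (Hlim U oU Ux) HN)) as [i [H2 [_ H3]]].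
    (* Writing [y] as [act (t i) (act (inv (t i)) y)] identifies the value at [y] of the inverse in
       [E] of the translation by [t i] with [act (inv (t i)) y]. *)
    apply H3. rewrite <- (act_inv_r (t i) y) in H2.
    pose proof (invK (translation (t i)) (act (inv (t i)) y)) as H4. simpl in H4.
    rewrite H4 in H2. exact H2.
Qed.

(** * From almost automorphy to the group structure *)

Section AlmostAutomorphic.

Context (Haa : forall x, almost_automorphic oX inv act x).

(* Almost automorphy of x, applied to the net of all pairs (W, t) with W a neighbourhood of p
   and t in W. *)
Lemma inverse_translations_near (p : X -> X) (x : X) (U : X -> Prop) :
  enveloping oX act p -> oX U -> U x ->
  exists W, pw_open oX W /\ W p /\ forall t, W (act t) -> U (act (inv t) (p x)).
Proof.
  intros Hp oU Ux. apply NNPP. intro N.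
  assert (N' : forall W, pw_open oX W -> W p ->
    exists t, W (act t) /\ ~ U (act (inv t) (p x))).
  { intros W oW Wp. apply NNPP. intro N'. apply N. exists W.
    split; [exact oW | split; [exact Wp |]]. intros t Wt. apply NNPP. intro NU.
    apply N'. exists t. auto. }
  (* Only pairs violating the claim are kept as indices. By [N'] every neighbourhood of [p] still
     occurs, which makes [J] directed under reverse inclusion. *)
  pose (J := { i : ((X -> X) -> Prop) * G | pw_open oX (fst i) /\ fst i p /\
    fst i (act (snd i)) /\ ~ U (act (inv (snd i)) (p x)) }).
  pose (le := fun i j : J => forall f, fst (proj1_sig j) f -> fst (proj1_sig i) f).
  assert (Hex : forall W, pw_open oX W -> W p -> exists i : J, fst (proj1_sig i) = W).
  { intros W oW Wp. destruct (N' W oW Wp) as [t [Wt Ht]].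
    exists (exist (fun i => pw_open oX (fst i) /\ fst i p /\
      fst i (act (snd i)) /\ ~ U (act (inv (snd i)) (p x))) (W, t)
      (conj oW (conj Wp (conj Wt Ht)))). reflexivity. }
  destruct (Hex (fun _ => True)) as [j0 _]; [apply open_true, pw_topology | exact I |].
  destruct (Haa x J le (fun i => snd (proj1_sig i)) (p x)) with (U := U) as [i Hi].
  - split; [exact (inhabits j0) | split; [| split]].
    + intros i f Hf. exact Hf.
    + intros i j k Hij Hjk f Hf. apply Hij, Hjk, Hf.
    + intros i j.
      destruct (Hex (fun f => fst (proj1_sig i) f /\ fst (proj1_sig j) f)) as [k Hk].
      * apply open_and; [apply pw_topology | apply (proj2_sig i) | apply (proj2_sig j)].
      * split; [apply (proj2_sig i) | apply (proj2_sig j)].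
      * exists k. unfold le. rewrite Hk. split; tauto.
  - intros V oV Vp.
    destruct (Hex (fun f => V (f x)) (eval_open X oX x V oV) Vp) as [i Hi].
    exists i. intros j Hij. unfold le in Hij. rewrite Hi in Hij.
    apply Hij, (proj2_sig j).
  - exact oU.
  - exact Ux.
  - destruct i as [[W t] [oW [Wp [Wt Ht]]]]. exact (Ht (Hi _ (fun f Hf => Hf))).
Qed.

(** Along an ultrafilter on [G] for which [act t] tends to [p], let [q] be a limit of the inverse
    translations. Then [act (inv t) (p x)] tends both to [q (p x)] and, by almost automorphy, to
    [x]. *)
Lemma enveloping_left_inverse (p : E) :
  exists q : E, forall x, proj1_sig q (proj1_sig p x) = x.
Proof.
  destruct (ultrafilter_of_base G
    (fun S => exists W, pw_open oX W /\ W (proj1_sig p) /\ S = fun t => W (act t)))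
    as [F [HF HB]].
  - exists (fun _ => True), (fun _ => True).
    split; [apply open_true, pw_topology | split; [exact I | reflexivity]].
  - intros S S' [W [oW [Wp ->]]] [W' [oW' [Wp' ->]]].
    exists (fun t => W (act t) /\ W' (act t)). split; [| auto].
    exists (fun f => W f /\ W' f).
    split; [apply open_and; [apply pw_topology | |]; assumption | auto].
  - intros S [W [oW [Wp ->]]]. exact (enveloping_meets _ W (proj2_sig p) oW Wp).
  - destruct (enveloping_limit G F (fun t => translation (inv t)) HF) as [q Hq].
    exists q. intro x.
    apply (limit_unique G X oX F (fun t => act (inv t) (proj1_sig p x)));
      [exact HXh | exact HF | |].
    + exact (limit_continuous _ _ _ _ _ F _ _ q (eval_continuous X oX _ _) Hq).
    + intros U oU Ux.
      destruct (inverse_translations_near _ x U (proj2_sig p) oU Ux) as [W [oW [Wp HW]]].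
      apply (uf_up F HF (fun t => W (act t))); [| exact HW].
      apply HB. exists W. auto.
Qed.

Lemma enveloping_inverse (p : E) : exists q : E,
  (forall x, proj1_sig q (proj1_sig p x) = x) /\ (forall x, proj1_sig p (proj1_sig q x) = x).
Proof.
  destruct (enveloping_left_inverse p) as [q Hq].
  destruct (enveloping_left_inverse q) as [r Hr].
  exists q. split; [exact Hq |]. intro x.
  rewrite <- (Hr (proj1_sig p (proj1_sig q x))), Hq. apply Hr.
Qed.

(** Density transfers the estimate from translations to [E]. If [r] is in [W] but [iv r] sends [x]
    outside [V], regularity separates that value from [V'] by an open [O]; a translation [t] close
    enough to [r] then has [act (inv t) x] in both [O] and [V']. *)
Lemma inverse_continuous (iv : E -> E) :
  (forall p x, proj1_sig p (proj1_sig (iv p) x) = x) -> continuous oE oE iv.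
Proof.
  intros Hiv. apply pointwise_continuous; [exact enveloping_topology |].
  intros x V oV. apply open_of_nbhd; [exact enveloping_topology |].
  intros p Vp. destruct (regular X oX HXt HXc HXh _ V oV Vp) as [V' [oV' [Vp' HV']]].
  destruct (inverse_translations_near _ _ V' (proj2_sig p) oV' Vp') as [W [oW [Wp HW]]].
  rewrite Hiv in HW.
  exists (fun r => W (proj1_sig r)). split; [| split; [exact Wp |]].
  - exists W. split; [exact oW | reflexivity].
  - intros r Wr. apply NNPP. intro NV. destruct (HV' _ NV) as [O [oO [Or dis]]].
    destruct (inverse_translations_near _ _ O (proj2_sig r) oO Or) as [W2 [oW2 [W2r HW2]]].
    rewrite Hiv in HW2.
    destruct (enveloping_meets _ (fun f => W f /\ W2 f) (proj2_sig r)) as [t [Ht Ht2]].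
    + apply open_and; [apply pw_topology | |]; assumption.
    + auto.
    + exact (dis _ (HW2 t Ht2) (HW t Ht)).
Qed.

Lemma almost_automorphic_enveloping_group : enveloping_is_CH_group oX act.
Proof.
  pose (iv := fun p => proj1_sig (constructive_indefinite_description _ (enveloping_inverse p))).
  assert (Hl : forall p x, proj1_sig (iv p) (proj1_sig p x) = x).
  { intro p. exact (proj1 (proj2_sig
      (constructive_indefinite_description _ (enveloping_inverse p)))). }
  assert (Hr : forall p x, proj1_sig p (proj1_sig (iv p) x) = x).
  { intro p. exact (proj2 (proj2_sig
      (constructive_indefinite_description _ (enveloping_inverse p)))). }
  clearbody iv.
  pose proof (inverse_continuous iv Hr) as Hivc.
  pose (mulE := fun p q : E => exist (enveloping oX act) (fun x => proj1_sig p (proj1_sig q x))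
                        (enveloping_comp _ _ (proj2_sig p) (proj2_sig q)) : E).
  assert (Eext : forall p q : E, (forall x, proj1_sig p x = proj1_sig q x) -> p = q).
  { intros [p Hp] [q Hq] H. apply subset_eq_compat, functional_extensionality, H. }
  assert (right : forall q, continuous oE oE (fun p => mulE p q)).
  { intro q. apply pointwise_continuous; [exact enveloping_topology |].
    intro x. apply eval_continuous. }
  assert (left : forall (p : E) x, continuous oE oX (fun q => proj1_sig p (proj1_sig q x))).
  { intros p x.
    apply (continuous_ext E X oE oX (fun q => proj1_sig (iv (mulE (iv q) (iv p))) x)).
    - intro q.
      pose proof (Hl (mulE (iv q) (iv p)) (proj1_sig p (proj1_sig q x))) as H.
      simpl in H. rewrite !Hl in H. exact H.
    - apply (continuous_comp E E X oE oE oX (fun q => iv (mulE (iv q) (iv p)))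
        (fun s : E => proj1_sig s x)); [| apply eval_continuous].
      apply (continuous_comp E E E oE oE oE (fun q => mulE (iv q) (iv p)) iv); [| exact Hivc].
      exact (continuous_comp E E E oE oE oE iv (fun q => mulE q (iv p)) Hivc (right _)). }
  assert (joint : continuous (product_open oE oE) oE (fun s => mulE (fst s) (snd s))).
  { apply pointwise_continuous; [apply product_topology; exact enveloping_topology |].
    intros x V oV [p0 q0] V0. simpl in V0.
    destruct (entourage_nbhd X oX HXt HXc HXh V _ oV V0) as [D [HD DV]].
    destruct (entourage_half X oX HXt HXc HXh D HD) as [D' [HD' HDD]].
    destruct (small_oscillation X oX HXt HXc HXh E E oE oE
      enveloping_topology enveloping_compact enveloping_topology enveloping_compact
      (fun p q : E => proj1_sig p (proj1_sig q x)) (fun q => eval_continuous X oX _ _)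
      (fun p => left p x) p0 D' HD') as [O [oO [[v Ov] HO]]].
    destruct (HD' (proj1_sig p0 (proj1_sig q0 x))) as [U [oU [U0 HU]]].
    (* Right multiplication by the inverse of [p0] times [v] carries [p0] to [v], so this is the set
       [O] of small oscillation moved to a neighbourhood of [p0]. *)
    exists (fun p => O (mulE p (mulE (iv p0) v))),
      (fun q : E => U (proj1_sig p0 (proj1_sig q x))).
    split; [exact (right _ O oO) | split; [exact (left p0 x U oU) |]].
    split; [| split; [exact U0 |]].
    - simpl. replace (mulE p0 (mulE (iv p0) v)) with v; [exact Ov |].
      apply Eext. intro z. simpl. rewrite Hr. reflexivity.
    - intros [p q] Op Uq. simpl in *. apply DV.
      apply (HDD _ (proj1_sig p0 (proj1_sig q x))); [apply HU; assumption |].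
      (* The second argument is chosen to cancel the translation: [v] sends it to [p0 q], and the
         translate of [p] sends it to [p q]. Uniformity of [HO] in that argument is essential, as it
         depends on [q]. *)
      pose proof (HO _ _ Ov Op (mulE (iv v) (mulE p0 q))) as H. simpl in H.
      rewrite Hr, Hl in H. exact H. }
  exists mulE. split; [reflexivity |].
  exists iv, (translation one).
  split; [| split; [exact enveloping_compact | apply hausdorff_pointwise, HXh]].
  split; [exact enveloping_topology |].
  split; [intros a b c; apply Eext; reflexivity |].
  split; [intro a; split; apply Eext; intro x; simpl; rewrite act_one; reflexivity |].
  split; [| split; [exact joint | exact Hivc]].
  intro a. split; apply Eext; intro x; simpl; rewrite act_one; [apply Hl | apply Hr].
Qed.

End AlmostAutomorphic.

End Flow.

Theorem mainTheorem4 (G : Type) (oG : (G -> Prop) -> Prop)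
  (mul : G -> G -> G) (inv : G -> G) (one : G)
  (HG : is_topological_group oG mul inv one)
  (X : Type) (oX : (X -> Prop) -> Prop)
  (HXt : is_topology oX) (HXc : compact oX) (HXh : hausdorff oX)
  (act : G -> X -> X) (Hact : is_continuous_action oG oX mul one act) :
  (forall x : X, almost_automorphic oX inv act x) <->
  enveloping_is_CH_group oX act.
Proof.
  split.
  - eapply almost_automorphic_enveloping_group; eassumption.
  - eapply enveloping_group_almost_automorphic; eassumption.
Qed.
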